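(* Let $n\geq1$, $q<p<0$ and $\lambda<0$ be such that $\frac1{p'}+\frac1q+\frac{\lambda}{n}=0$, where $\frac1p+\frac1{p'}=1$ and $\frac1q+\frac1{q'}=1$. Then there is a constant $C>0$, independent of $f$ and $h$, such that for all non-negative functions $f\in L^{q'}(\mathbb{R}^n)$ and all non-negative $h$ with $0<\int_{\mathbb{R}^n}h^p(x)\,dx<\infty$, $$\int_{\mathbb{R}^n}\int_{\mathbb{R}^n}f(x)|x-y|_E^{\lambda}h(y)\,dx\,dy\geq C\left(\int_{\mathbb{R}^n}f^{q'}(x)\,dx\right)^{\frac1{q'}}\left(\int_{\mathbb{R}^n}h^{p}(x)\,dx\right)^{\frac1p}.$$
   Context: $|\cdot|_E$ is the Euclidean norm on $\mathbb{R}^n$. Since $p,q<0$, one has $p',q'\in(0,1)$; $f\in L^{q'}(\mathbb{R}^n)$ means that $f$ is measurable with $\int_{\mathbb{R}^n}|f|^{q'}dx<\infty$. Functions are measurable, and for $r<0$ the convention $0^{r}=+\infty$ is used (so $\int h^p<\infty$ forces $h>0$ almost everywhere). *)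

(* Defs.v *)
From HB Require Import structures.
From mathcomp Require Import all_boot all_order all_algebra.
From mathcomp Require Import all_classical all_reals all_analysis.

Set Implicit Arguments.
Unset Strict Implicit.
Unset Printing Implicit Defensive.

Import Order.TTheory GRing.Theory Num.Theory.
Import numFieldNormedType.Exports.

Local Open Scope classical_set_scope.
Local Open Scope ring_scope.

(* Lebesgue measure on the Borel sigma-algebra of R^n, the latter being the
   product sigma-algebra carried by n-tuples.  It is built by recursion on n:
   the measure on R^(n+1) is the image of the product of the measures on R and
   R^n under (a, t) |-> (a, t_0, ..., t_(n-1)). *)
Section borel_lebesgue.
Context {R : realType}.

Definition tcons n (z : measurableTypeR R * n.-tuple (measurableTypeR R)) :
  n.+1.-tuple (measurableTypeR R) := [tuple of z.1 :: z.2].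

Lemma measurable_tcons n : measurable_fun setT (@tcons n).
Proof.
exact: (measurable_cons (f := fst) (g := snd)).
Qed.

HB.instance Definition _ n := isMeasurableFun.Build _ _ _ _ (@tcons n)
  (@measurable_tcons n).

Definition tsplit n (t : n.+1.-tuple (measurableTypeR R)) :
  measurableTypeR R * n.-tuple (measurableTypeR R) :=
  (thead t, [tuple of behead t]).

Lemma tconsK n : cancel (@tcons n) (@tsplit n).
Proof. by move=> [a t]; congr pair; apply/val_inj. Qed.

Lemma measurable_tsplit n : measurable_fun setT (@tsplit n).
Proof.
apply: measurable_fun_pair; first exact: measurable_tnth.
exact: measurable_behead.
Qed.

Section step.
Variables (n : nat).
Variable m : {sigma_finite_measure set (n.-tuple (measurableTypeR R)) -> \bar R}.

Definition lebesgue_step : set (n.+1.-tuple (measurableTypeR R)) -> \bar R :=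
  pushforward (lebesgue_measure \x m)%E (@tcons n).

Let lebesgue_step0 : lebesgue_step set0 = 0%E.
Proof. exact: measure0. Qed.

Let lebesgue_step_ge0 A : (0 <= lebesgue_step A)%E.
Proof. exact: measure_ge0. Qed.

Let lebesgue_step_sigma_additive : semi_sigma_additive lebesgue_step.
Proof. exact: measure_semi_sigma_additive. Qed.

HB.instance Definition _ := isMeasure.Build _ _ _ lebesgue_step
  lebesgue_step0 lebesgue_step_ge0 lebesgue_step_sigma_additive.

Lemma sigma_finite_lebesgue_step : sigma_finite setT lebesgue_step.
Proof.
have /sigma_finiteP[F [TF ndF Foo]] := sigma_finiteT (@lebesgue_measure R).
have /sigma_finiteP[G [TG ndG Goo]] := sigma_finiteT m.
exists (fun k => @tsplit n @^-1` (F k `*` G k)).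
  rewrite -preimage_bigcup (_ : \bigcup_k _ = setT) ?preimage_setT//.
  rewrite -setXTT TF TG predeqE => -[x y]; split.
    by move=> [/= k _ []/= ? ?]; split; exists k.
  move=> [/= [k _ Fkx] [l _ Gly]]; exists (maxn k l) => //; split.
  - by move: x Fkx; exact/subsetPset/ndF/leq_maxl.
  - by move: y Gly; exact/subsetPset/ndG/leq_maxr.
move=> k; have [mF Fk] := Foo k; have [mG Gk] := Goo k; split.
  rewrite -[X in measurable X]setTI; apply: measurable_tsplit => //.
  exact: measurableX.
rewrite /lebesgue_step /pushforward -comp_preimage.
rewrite (_ : @tsplit n \o @tcons n = id); last first.
  by apply/funext => z; exact: tconsK.
by rewrite preimage_id product_measure1E// lte_mul_pinfty// ge0_fin_numE.
Qed.

HB.instance Definition _ := Measure_isSigmaFinite.Build _ _ _ lebesgue_step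
  sigma_finite_lebesgue_step.

End step.

Fixpoint borel_lebesgue n :
    {sigma_finite_measure set (n.-tuple (measurableTypeR R)) -> \bar R} :=
  match n with
  | 0 => dirac ([tuple] : 0.-tuple (measurableTypeR R))
  | k.+1 => lebesgue_step (borel_lebesgue k)
  end.

Lemma measurable_box n (A : 'I_n -> set (measurableTypeR R)) :
  (forall i, measurable (A i)) ->
  measurable [set t : n.-tuple (measurableTypeR R) | forall i, A i (tnth t i)].
Proof.
move=> mA; rewrite (_ : mkset _ = \bigcap_(i in [set: 'I_n])
  (fun t : n.-tuple (measurableTypeR R) => tnth t i) @^-1` (A i)).
  apply: fin_bigcap_measurable => // i _.
  by rewrite -[X in measurable X]setTI; exact: measurable_tnth.
by apply/seteqP; split => [t H i _|t H i]; [exact: H|exact: H].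
Qed.

Lemma borel_lebesgue_box n (A : 'I_n -> set (measurableTypeR R)) :
  (forall i, measurable (A i)) ->
  borel_lebesgue n [set t | forall i, A i (tnth t i)] =
  (\prod_(i < n) lebesgue_measure (A i))%E.
Proof.
elim: n A => [A _|n IH A mA].
  by rewrite big_ord0 /= diracE mem_set// => -[].
rewrite big_ord_recl -IH; last by move=> i; exact: mA.
rewrite /= /lebesgue_step /pushforward.
rewrite -product_measure1E//.
  congr (_ _); apply/seteqP; split => [[a t] /= H|[a t] /= [H0 H] i].
    by split => [|i]; [have := H ord0|have := H (lift ord0 i); rewrite tnthS].
  have [->//|] := eqVneq i ord0.
  by case: (unliftP ord0 i) => [j -> _|-> //]; rewrite tnthS; exact: H.
by apply: (@measurable_box n (fun i => A (lift ord0 i))) => i; exact: mA.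
Qed.

End borel_lebesgue.

(* R^n with the Lebesgue measurable sets (the Caratheodory measurable sets of
   the outer measure induced by borel_lebesgue), and the complete Lebesgue
   measure on them. *)
Definition euclid (R : realType) (n : nat) : measurableType _ :=
  caratheodory_type (@borel_lebesgue R n)^*%mu.

Definition lebesgue_Rn {R : realType} (n : nat) :
    {measure set (euclid R n) -> \bar R} :=
  @completed_measure_extension _ _ _ (@borel_lebesgue R n).

Lemma lebesgue_Rn_box {R : realType} n (A : 'I_n -> set (measurableTypeR R)) :
  (forall i, measurable (A i)) ->
  lebesgue_Rn n [set t : n.-tuple R | forall i, A i (tnth t i)] =
  (\prod_(i < n) lebesgue_measure (A i))%E.
Proof.
move=> mA; rewrite -borel_lebesgue_box//.
by apply: measurable_mu_extE; exact: (measurable_box mA).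
Qed.

Definition eucl_dist {R : realType} n (x y : n.-tuple R) : R :=
  Num.sqrt (\sum_(i < n) (tnth x i - tnth y i) ^+ 2).

(* Real powers of non-negative reals with 0^r = +oo for r < 0; the library's
   powR has 0 `^ r = 0 there. *)
Definition epow {R : realType} (a r : R) : \bar R :=
  if (a == 0) && (r < 0) then +oo%E else (a `^ r)%:E.

(* Main.v *)
Require Import Defs.
From HB Require Import structures.
From mathcomp Require Import all_boot all_order all_algebra.
From mathcomp Require Import all_classical all_reals all_analysis.
From mathcomp Require Import measurable_realfun ring lra.

Import Order.TTheory GRing.Theory Num.Theory.
Import numFieldNormedType.Exports.

Local Open Scope classical_set_scope.
Local Open Scope ring_scope.

(** The hypotheses force [lambda < -n], so the kernel is so singular that its
    double integral over [A x A] diverges for every set [A] of positive measure: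
    cutting a cube containing [A] into [N^n] cells of diameter of order [1/N],
    the pairs of points lying in a common cell have total mass at least
    [|A|^2 / N^n] by Cauchy-Schwarz, and there the kernel is at least of order
    [N^(-lambda)].  As [h > 0] almost everywhere, either [f] vanishes almost
    everywhere and the right-hand side is [0], or [f] and [h] are both bounded
    below on a bounded set of positive measure and the double integral is
    infinite; hence any constant, for instance [1], works. *)

(** * Lower bounds for double integrals from a finite partition *)

Lemma sqr_sum_le_card (R : realFieldType) (I : finType) (a : I -> R) :
  (\sum_i a i) ^+ 2 <= #|I|%:R * \sum_i a i ^+ 2.
Proof.
case: (posnP #|I|) => [I0|I_gt0].
  by rewrite I0 mul0r big1 ?expr0n// => i; have := fintype0 i I0.
have N_gt0 : 0 < #|I|%:R :> R by rewrite ltr0n.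
set S := \sum_i a i; set N := #|I|%:R.
(* Each square lies above its tangent line at the mean [S / N]; summing the tangents gives
   [S ^+ 2 / N]. *)
have : \sum_i (S / N) * (2 * a i - S / N) <= \sum_i a i ^+ 2.
  by apply: ler_sum => i _; have := sqr_ge0 (a i - S / N); nra.
rewrite -mulr_sumr sumrB -mulr_sumr -/S sumr_const -[X in _ - X]mulr_natr -/N.
rewrite divfK ?gt_eqF// (_ : S / N * (2 * S - S) = S ^+ 2 / N); last by ring.
by rewrite ler_pdivrMr// mulrC.
Qed.

(* The integral of a non-negative function, even a non-measurable one, is a
   supremum over the simple functions below it. *)
Lemma ge0_le_integral_nomeas {d} {T : measurableType d} {R : realType}
    (mu : {measure set T -> \bar R}) (f g : T -> \bar R) :
  (forall x, 0 <= f x)%E -> (forall x, f x <= g x)%E ->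
  (\int[mu]_x f x <= \int[mu]_x g x)%E.
Proof.
move=> f0 fg; rewrite !ge0_integralTE//; last first.
  by move=> x; exact: le_trans (f0 x) (fg x).
apply: le_ereal_sup => _ [h hf <-]; exists h => // x.
exact: le_trans (hf x) (fg x).
Qed.

(** With [P i] the part of [A] of colour [i], the inner integral at [y] in [P i] is at least
    [r * mu (P i)], so the double integral is at least [r] times the sum of the [mu (P i) ^+ 2];
    Cauchy-Schwarz concludes. [K] need not be measurable, so only monotonicity is applied to its
    integrals. *)
Lemma double_integral_ge_partition {d} {T : measurableType d} {R : realType}
    (mu : {measure set T -> \bar R}) (I : finType) (c : T -> I) (A : set T)
    (K : T -> T -> \bar R) (r : R) :
  measurable A -> (mu A < +oo)%E ->
  (forall i, measurable (A `&` c @^-1` [set i])) ->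
  0 <= r -> (forall x y, 0 <= K x y)%E ->
  (forall x y, A x -> A y -> c x = c y -> r%:E <= K x y)%E ->
  ((r * fine (mu A) ^+ 2 / #|I|%:R)%:E <= \int[mu]_y \int[mu]_x K x y)%E.
Proof.
move=> mA Aoo mAc r0 K0 rK.
pose P i := A `&` c @^-1` [set i].
have {}mAc i : measurable (P i) by exact: mAc.
have fP i : mu (P i) \is a fin_num.
  rewrite ge0_fin_numE//; apply: le_lt_trans Aoo.
  by apply: le_measure; rewrite ?inE; [exact: mAc|exact: mA|exact: subIsetl].
have mP i (k : R) : measurable_fun [set: T] (fun y => (k * \1_(P i) y)%:E).
  apply/measurable_EFinP; apply: measurable_funM; first exact: measurable_cst.
  exact: measurable_indic (mAc i).
have int_step (a : I -> R) : (forall i, 0 <= a i) ->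
    (\int[mu]_y (\sum_i (a i * \1_(P i) y)%:E) =
     \sum_i (a i * fine (mu (P i)))%:E)%E.
  move=> a0; rewrite ge0_integral_sum//; last first.
    by move=> i x _; rewrite lee_fin mulr_ge0.
  apply: eq_bigr => i _; under eq_integral do rewrite EFinM.
  rewrite ge0_integralZl//; last by rewrite lee_fin.
    by rewrite integral_indic// setIT EFinM fineK.
  by apply/measurable_EFinP; exact: measurable_indic.
have stepE (a : I -> R) y : A y -> \sum_i (a i * \1_(P i) y)%:E = (a (c y))%:E.
  move=> Ay; rewrite (bigD1 (c y))//= big1 => [|i /eqP ic].
    by rewrite adde0 indicE mem_set ?mulr1.
  by rewrite indicE memNset ?mulr0// => -[_ /= /esym].
have step0 (a : I -> R) y : ~ A y -> \sum_i (a i * \1_(P i) y)%:E = 0%E.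
  by move=> Ay; rewrite big1// => i _; rewrite indicE memNset ?mulr0// => -[].
have muA : fine (mu A) = \sum_i fine (mu (P i)).
  have := int_step (fun=> 1) (fun=> ler01); rewrite sumEFin.
  under [X in _ = X%:E -> _]eq_bigr do rewrite mul1r.
  move=> E; apply: EFin_inj; rewrite -E fineK ?ge0_fin_numE//.
  rewrite -[in LHS](setIT A) -integral_indic//.
  apply: eq_integral => y _; have [Ay|Ay] := pselect (A y).
    by rewrite stepE// indicE mem_set.
  by rewrite step0// indicE memNset.
(* The intermediate integrand is [r * mu (P (c y))] for [y] in [A] and [0] elsewhere. *)
apply: (@le_trans _ _ (\int[mu]_y
    \sum_i ((r * fine (mu (P i))) * \1_(P i) y)%:E)%E); last first.
  apply: ge0_le_integral_nomeas => y.
    by apply: sume_ge0 => i _; rewrite lee_fin !mulr_ge0.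
  have [Ay|Ay] := pselect (A y); last by rewrite step0// integral_ge0.
  rewrite stepE//.
  have -> : (r * fine (mu (P (c y))))%:E =
      (\int[mu]_x (r%:E * (\1_(P (c y)) x)%:E))%E.
    rewrite ge0_integralZl//; last first.
      by apply/measurable_EFinP; exact: measurable_indic.
    by rewrite integral_indic// setIT EFinM fineK.
  apply: ge0_le_integral_nomeas => x; first by rewrite mule_ge0 ?lee_fin.
  rewrite indicE; case: (boolP (x \in P _)) => [/set_mem[Ax /= cxy]|_]; last first.
    by rewrite mule0.
  by rewrite mule1; exact: rK.
rewrite int_step => [|i]; last by rewrite mulr_ge0.
rewrite sumEFin lee_fin.
under eq_bigr do rewrite -mulrA -expr2.
rewrite -mulr_sumr -mulrA ler_wpM2l//.
(* For empty [I], division by zero makes the left side [0]. *)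
have [->|I0] := eqVneq #|I| 0%N.
  by rewrite invr0 mulr0 sumr_ge0// => i _; exact: sqr_ge0.
rewrite ler_pdivrMr ?ltr0n ?lt0n// mulrC muA.
exact: sqr_sum_le_card.
Qed.

(** * Subdivision of a cube into congruent cells *)

Section cells.
Context {R : realType} {n : nat}.
Implicit Types L : R.

Definition cube L : set (euclid R n) :=
  [set t | forall i, (tnth t i : R) \in `[- L, L[ ].

Definition cell_side (K : nat) L : R := 2 * L / K.+1%:R.

(** The index is meaningful only on [cube L]; outside, [Num.truncn] and [inord] may return default
    values. *)
Definition cell K L (t : euclid R n) : {ffun 'I_n -> 'I_K.+1} :=
  [ffun i => inord (Num.truncn ((tnth t i + L) / cell_side K L))].

Lemma measurable_box_euclid (A : 'I_n -> set R) :
  (forall i, measurable (A i)) ->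
  measurable ([set t | forall i, A i (tnth t i)] : set (euclid R n)).
Proof.
move=> mA; apply: sub_caratheodory; apply: sub_sigma_algebra.
exact: measurable_box.
Qed.

Lemma measurable_cube L : measurable (cube L).
Proof.
by apply: (@measurable_box_euclid (fun=> [set` `[- L, L[ ])) => i.
Qed.

Lemma lebesgue_cube_lty L : (lebesgue_Rn n (cube L) < +oo)%E.
Proof.
have -> := @lebesgue_Rn_box R n (fun=> [set` `[- L, L[ ]); last by [].
under eq_bigr do rewrite lebesgue_measure_itv/=.
rewrite big_const_ord; elim: n => [|k IH] /=; first exact: ltry.
case: ifP IH => [|_ _]; last by rewrite mul0e ltry.
rewrite lte_fin => LL IH; rewrite lte_mul_pinfty// lee_fin; lra.
Qed.

Lemma truncn_cellP K L (a : R) (k : 'I_K.+1) : 0 < L -> a \in `[- L, L[ ->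
  inord (Num.truncn ((a + L) / cell_side K L)) = k <->
  a \in `[k%:R * cell_side K L - L, k.+1%:R * cell_side K L - L[.
Proof.
move=> L0; rewrite !in_itv/= => /andP[La aL].
have d0 : 0 < cell_side K L by rewrite divr_gt0 ?mulr_gt0.
have s0 : 0 <= (a + L) / cell_side K L
  by apply: divr_ge0; [lra|exact: ltW].
(* The strict bound [a < L] keeps the index in the range where [inord] is faithful. *)
have sK : (Num.truncn ((a + L) / cell_side K L) < K.+1)%N.
  rewrite truncn_lt_nat// ltr_pdivrMr// /cell_side mulrC divfK ?pnatr_eq0//.
  lra.
rewrite lerBlDr ltrBrDr -ler_pdivlMr// -ltr_pdivrMr// -truncn_eq//.
split => [<-|/eqP tk]; first by rewrite inordK.
by apply: val_inj; rewrite /= inordK ?tk.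
Qed.

Lemma measurable_cell K L j : 0 < L ->
  measurable (cube L `&` cell K L @^-1` [set j]).
Proof.
move=> L0; pose A i : set R := [set` `[- L, L[ ] `&`
  [set` `[(j i)%:R * cell_side K L - L, (j i).+1%:R * cell_side K L - L[ ].
rewrite (_ : _ `&` _ = [set t : n.-tuple R | forall i, A i (tnth t i)]).
  by apply: (@measurable_box_euclid A) => i; exact: measurableI.
apply/seteqP; split => [t [tL tj] i|t tA].
  by split; [exact: tL|apply/truncn_cellP => //; rewrite -tj ffunE].
have tL : cube L t by move=> i; exact: (tA i).1.
split=> //; apply/ffunP => i; rewrite ffunE; apply/truncn_cellP => //.
exact: (tA i).2.
Qed.

(** Corresponding coordinates share an interval of length [cell_side K L], and [n] squared
    differences are added. *)
Lemma eucl_dist_cell_le K L (x y : euclid R n) :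
  0 < L -> cube L x -> cube L y -> cell K L x = cell K L y ->
  eucl_dist x y <= Num.sqrt n%:R * cell_side K L.
Proof.
move=> L0 xL yL xy.
have d0 : 0 < cell_side K L by rewrite divr_gt0 ?mulr_gt0.
rewrite -[X in _ * X]gtr0_norm// -sqrtr_sqr -sqrtrM// ler_wsqrtr//.
apply: (@le_trans _ _ (\sum_(i < n) cell_side K L ^+ 2)); last first.
  by rewrite sumr_const card_ord mulr_natl.
apply: ler_sum => i _; rewrite -[leLHS]real_normK ?num_real//.
rewrite ler_sqr ?nnegrE ?normr_ge0 ?(ltW d0)//.
pose k t := inord (Num.truncn ((tnth t i + L) / cell_side K L)) : 'I_K.+1.
have /truncn_cellP : k x = cell K L x i by rewrite ffunE.
have /truncn_cellP : k y = cell K L x i by rewrite xy ffunE.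
move=> /(_ L0 (yL i)) + /(_ L0 (xL i)).
rewrite !in_itv/= -natr1 mulrDl mul1r => /andP[y1 y2] /andP[x1 x2].
by rewrite ler_norml; apply/andP; split; lra.
Qed.

End cells.

(** * Extended powers and their growth *)

Lemma epow_ge_powR {R : realType} (a b r : R) :
  0 <= a <= b -> 0 < b -> r < 0 -> ((b `^ r)%:E <= epow a r)%E.
Proof.
(* The case [a = 0] covers the diagonal of the kernel, where [epow] is [+oo]. *)
move=> /andP[a0 ab] b0 r0; rewrite /epow r0 andbT; case: eqP => [_|/eqP aN0].
  exact: leey.
have {}a0 : 0 < a by rewrite lt_neqAle eq_sym aN0.
rewrite lee_fin -[r]opprK !(powRN _ (- r)) lef_pV2 ?posrE ?powR_gt0//.
by apply: ge0_ler_powR; rewrite ?nnegrE//; lra.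
Qed.

Lemma epow_ge0 {R : realType} (a r : R) : (0 <= epow a r)%E.
Proof. by rewrite /epow; case: ifP => // _; rewrite lee_fin powR_ge0. Qed.

Lemma powR_unbounded {R : realType} (s c r : R) : 0 < s -> 0 < c -> 0 < r ->
  exists K : nat, r <= c * K.+1%:R `^ s.
Proof.
(* The equation [c * t ^ s = r] has the solution [t = (r / c) ^ (1 / s)], and [K.+1] exceeds it. *)
move=> s0 c0 r0; exists (Num.truncn ((r / c) `^ s^-1)).
have rc0 : 0 < r / c by exact: divr_gt0.
rewrite mulrC -ler_pdivrMr//.
rewrite [leLHS](_ : _ = ((r / c) `^ s^-1) `^ s); last first.
  by rewrite -powRrM mulVf ?lt0r_neq0// powRr1// ltW.
apply: ge0_ler_powR; rewrite ?nnegrE ?powR_ge0 ?(ltW s0)//.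
exact/ltW/truncnS_gt.
Qed.

(** Separates the dependence on [K] in the partition bound: the kernel gains [K.+1 ^ (- lambda)] and
    the number of cells costs [K.+1 ^ n]. *)
Lemma cell_energy {R : realType} n (K : nat) (L lambda c a : R) :
  0 < L ->
  c * (Num.sqrt n%:R * cell_side K L) `^ lambda * c * a ^+ 2 / K.+1%:R ^+ n =
  (c ^+ 2 * (Num.sqrt n%:R * (2 * L)) `^ lambda * a ^+ 2)
  * K.+1%:R `^ (- lambda - n%:R).
Proof.
move=> L0; have K0 : 0 < K.+1%:R :> R by rewrite ltr0n.
have X0 : 0 <= Num.sqrt n%:R * (2 * L) by rewrite !mulr_ge0 ?sqrtr_ge0// ltW.
rewrite /cell_side (mulrA (Num.sqrt _)) powRM ?invr_ge0 ?ler0n//.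
rewrite -(powR_inv1 (ltW K0)) -powRrM mulN1r.
rewrite -(powR_mulrn n (ltW K0)) -powRN powRD; last by apply/implyP => _; rewrite gt_eqF.
by ring.
Qed.

(** * Divergence of the double integral *)

Lemma riesz_energy_pinfty {R : realType} n (lambda L c : R)
    (f h : euclid R n -> R) (A : set (euclid R n)) :
  (0 < n)%N -> lambda < - n%:R -> 0 < L -> 0 < c ->
  measurable A -> A `<=` cube L -> (0 < lebesgue_Rn n A)%E ->
  (forall x, 0 <= f x) -> (forall x, 0 <= h x) ->
  (forall x, A x -> c <= f x) -> (forall x, A x -> c <= h x) ->
  (\int[lebesgue_Rn n]_y \int[lebesgue_Rn n]_x
     ((f x)%:E * epow (eucl_dist x y) lambda * (h y)%:E) = +oo)%E.
Proof.
move=> n0 ln L0 c0 mA AL A0 f0 h0 fc hc; set mu := lebesgue_Rn n.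
have Aoo : (mu A < +oo)%E.
  apply: le_lt_trans (lebesgue_cube_lty L).
  by apply: le_measure; rewrite ?inE//; exact: measurable_cube.
have a0 : 0 < fine (mu A) by rewrite fine_gt0// A0.
have n0R : 0 < n%:R :> R by rewrite ltr0n.
have s0 : 0 < - lambda - n%:R by lra.
have l0 : lambda < 0 by lra.
apply/eqyP => r r0.
(* This factor is independent of [K], so refining the cells pushes the bound past any [r]. *)
have B0 : 0 < c ^+ 2 * (Num.sqrt n%:R * (2 * L)) `^ lambda * fine (mu A) ^+ 2.
  by rewrite !mulr_gt0 ?exprn_gt0// powR_gt0// !mulr_gt0// sqrtr_gt0.
have [K rK] := powR_unbounded _ _ _ s0 B0 r0.
have d0 : 0 < Num.sqrt n%:R * cell_side K L.
  by rewrite mulr_gt0 ?sqrtr_gt0// divr_gt0 ?mulr_gt0.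
apply: (@le_trans _ _ (c * (Num.sqrt n%:R * cell_side K L) `^ lambda * c
    * fine (mu A) ^+ 2 / #|{ffun 'I_n -> 'I_K.+1}|%:R)%:E).
  by rewrite card_ffun !card_ord natrX lee_fin cell_energy.
apply: (@double_integral_ge_partition _ _ _ mu _ (cell K L)) => //.
- move=> j; rewrite -(setIidl AL) -setIA.
  by apply: measurableI => //; exact: measurable_cell.
- by rewrite !mulr_ge0 ?powR_ge0 ?(ltW c0).
- by move=> x y; rewrite !mule_ge0 ?epow_ge0 ?lee_fin.
- move=> x y Ax Ay xy; rewrite 2!EFinM.
  have cd0 : (0 <= c%:E * ((Num.sqrt n%:R * cell_side K L) `^ lambda)%:E)%E.
    by rewrite -EFinM lee_fin mulr_ge0 ?powR_ge0 ?(ltW c0).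
  apply: lee_pmul; rewrite ?lee_fin ?(ltW c0) ?hc//.
  apply: lee_pmul; rewrite ?lee_fin ?(ltW c0) ?fc ?powR_ge0//.
  apply: epow_ge_powR => //; rewrite sqrtr_ge0/=.
  by apply: eucl_dist_cell_le => //; exact: AL.
Qed.

(** The integrand is [+oo] on the zero set of [h], so positive measure there would make the integral
    infinite. *)
Lemma epow_lty_null {d} {T : measurableType d} {R : realType}
    (mu : {measure set T -> \bar R}) (h : T -> R) (p : R) :
  p < 0 -> measurable_fun setT h -> (\int[mu]_x epow (h x) p < +oo)%E ->
  mu (h @^-1` [set 0]) = 0%E.
Proof.
move=> p0 mh hoo; apply/eqP/negPn/negP => N0.
move: hoo; rewrite ltNge => /negP; apply.
have mN : measurable (h @^-1` [set 0]).
  by rewrite -[X in measurable X]setTI; exact: mh.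
rewrite -(_ : \int[mu]_x (+oo * (\1_(h @^-1` [set 0]) x)%:E) = +oo)%E.
  apply: ge0_le_integral_nomeas => x; first by rewrite mule_ge0 ?lee_fin.
  rewrite indicE; have [/set_mem/= hx|_] := boolP (x \in _).
    by rewrite mule1 /epow hx eqxx p0.
  by rewrite mule0 epow_ge0.
rewrite ge0_integralZl//; last by apply/measurable_EFinP; exact: measurable_indic.
by rewrite integral_indic// setIT gt0_mulye// lt0e N0/=.
Qed.

(** * The inequality, by two cases *)

Theorem theorem3p4 (R : realType) (n : nat) (p q p' q' lambda : R)
    (hn : (1 <= n)%N) (hqp : q < p) (hp : p < 0) (hlambda : lambda < 0)
    (hp' : p^-1 + p'^-1 = 1) (hq' : q^-1 + q'^-1 = 1)
    (hpq : p'^-1 + q^-1 + lambda / n%:R = 0) :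
  exists C : R, 0 < C /\
    forall f h : euclid R n -> R,
      measurable_fun [set: euclid R n] f ->
      (forall x, 0 <= f x) ->
      (\int[lebesgue_Rn n]_x epow `|f x| q' < +oo)%E ->
      measurable_fun [set: euclid R n] h ->
      (forall x, 0 <= h x) ->
      (0 < \int[lebesgue_Rn n]_x epow (h x) p)%E ->
      (\int[lebesgue_Rn n]_x epow (h x) p < +oo)%E ->
      (C%:E * poweR (\int[lebesgue_Rn n]_x epow (f x) q') q'^-1
            * poweR (\int[lebesgue_Rn n]_x epow (h x) p) p^-1
       <= \int[lebesgue_Rn n]_y \int[lebesgue_Rn n]_x
            ((f x)%:E * epow (eucl_dist x y) lambda * (h y)%:E))%E.
Proof.
have n0 : 0 < n%:R :> R by rewrite ltr0n.
have q0 : q < 0 by exact: lt_trans hp.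
(* The exponent relations give [lambda / n = 1/p - 1/q - 1], and [q < p < 0] gives [1/p < 1/q]. *)
have lambda_lt : lambda < - n%:R.
  have pq : p^-1 < q^-1 by rewrite ltf_nV2 ?negrE.
  have : lambda / n%:R < -1 by lra.
  by rewrite ltr_pdivrMr// mulN1r.
have q'0 : 0 < q'.
  by rewrite -invr_gt0; have : q^-1 < 0 by [rewrite invr_lt0]; lra.
exists 1; split=> // f h mf f0 _ mh h0 _ hoo; set mu := lebesgue_Rn n.
pose c (m : nat) : R := m.+1%:R^-1.
have c0 m : 0 < c m by rewrite invr_gt0.
(* These sets exhaust the set where [f] and [h] are both positive. *)
pose E m := (f @^-1` `[c m, +oo[ `&` h @^-1` `[c m, +oo[) `&` cube m.+1%:R.
have mE m : measurable (E m).
  apply: measurableI; last exact: measurable_cube.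
  by apply: measurableI; rewrite -[X in measurable X]setTI;
    [exact: mf|exact: mh].
have [[m Em]|noE] := pselect (exists m, (0 < mu (E m))%E).
  rewrite (@riesz_energy_pinfty _ _ _ m.+1%:R (c m) _ _ (E m)) ?leey//.
  - by move=> x [].
  - by move=> x [[] /=]; rewrite in_itv/= andbT.
  - by move=> x [[] /= _]; rewrite in_itv/= andbT.
(* All [E m] are null here, so [f] vanishes almost everywhere and the right-hand side is [0]. *)
suff -> : (\int[mu]_x epow (f x) q' = 0)%E.
  rewrite poweR0r ?invr_eq0 ?gt_eqF// mule0 mul0e.
  apply: integral_ge0 => y _; apply: integral_ge0 => x _.
  by rewrite !mule_ge0 ?epow_ge0 ?lee_fin.
have E0 m : mu.-negligible (E m).
  apply/negligibleP => //; apply/eqP; rewrite eq_le measure_ge0 andbT leNgt.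
  by apply/negP => Em; apply: noE; exists m.
have h_null : mu.-negligible (h @^-1` [set 0]).
  apply/negligibleP; last exact: epow_lty_null hoo.
  by rewrite -[X in measurable X]setTI; exact: mh.
have fq'E x : epow (f x) q' = (f x `^ q')%:E.
  by rewrite /epow ltNge (ltW q'0) andbF.
rewrite (@ge0_ae_eq_integral _ _ _ mu setT _ (cst 0%E))//.
- by rewrite integral0.
- under eq_fun do rewrite fq'E.
  apply/measurable_EFinP.
  exact: (measurableT_comp (measurable_powR q')).
- by move=> x _; exact: epow_ge0.
(* A point with [f x != 0] lies in some [E m] or in the null set where [h] vanishes. *)
have := negligibleU (negligible_bigcup E0) h_null; apply: negligibleS.
move=> x /= /not_implyP[_]; rewrite fq'E => fx.
have fx0 : 0 < f x.
  rewrite lt_neqAle f0 andbT; apply/eqP => fx0; apply: fx.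
  by rewrite -fx0 powR0// gt_eqF.
have [hx|hx] := eqVneq (h x) 0; [by right|left].
have hx0 : 0 < h x by rewrite lt_neqAle h0 andbT eq_sym.
pose S := \sum_(i < n) `|tnth x i : R|.
have S0 : 0 <= S by exact: sumr_ge0.
(* Since all three terms are non-negative, one [m] serves both lower bounds and the cube. *)
have := truncnS_gt ((f x)^-1 + (h x)^-1 + S); set m := Num.truncn _ => xm.
have fV0 : 0 < (f x)^-1 by rewrite invr_gt0.
have hV0 : 0 < (h x)^-1 by rewrite invr_gt0.
exists m => //; split; first split; rewrite /= ?in_itv/= ?andbT.
- by rewrite /c invf_ple ?posrE//; lra.
- by rewrite /c invf_ple ?posrE//; lra.
move=> i; rewrite in_itv/=.
have : `|tnth x i| <= S by rewrite /S (bigD1 i)//= lerDl sumr_ge0.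
by rewrite ler_norml => /andP[? ?]; apply/andP; split; lra.
Qed.
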